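(* Let $\alpha>0$, let $A$ be an $n\times n$ nonsingular $M$-matrix, $R=A^{-1}$, $\overline R_{j,j}=R_{j,j}A_{j,j}$, and let $Z=(Z_1,\ldots,Z_n)=Z_{\alpha,\overline B}$ be the associated $\mathbb{N}^n$-valued random variable. Then for every $1\le j\le n$ and every integer $m_j\ge1$, $$\overline R_{j,j}^{\,m_{j}}=E\left(\prod_{l=0}^{m_{j}-1}\frac{\alpha+Z_{j}+l}{\alpha+l}\right).$$
   Context: A real matrix $A=\{a_{i,j}\}_{1\le i,j\le n}$ is a nonsingular $M$-matrix if $a_{i,j}\le 0$ for all $i\ne j$, $A$ is nonsingular, and all entries of $A^{-1}$ are nonnegative. $|M|$ denotes the determinant of a matrix $M$. Let $a_i=a_{i,i}=A_{i,i}$ be the diagonal entries of $A$ (they are positive), let $D_A=\mathrm{diag}(a_1,\ldots,a_n)$, and write $A=D_A-B$, so $B$ has nonnegative entries and zero diagonal. Set $\overline A=D_A^{-1}A=I-\overline B$ with $\overline B=D_A^{-1}B$. For $\alpha>0$ the $\alpha$-permanent of an $n\times n$ matrix $M$ is $|M|_\alpha=\sum_{\pi}\alpha^{c(\pi)}M_{1,\pi(1)}M_{2,\pi(2)}\cdots M_{n,\pi(n)}$, where the sum is over all permutations $\pi$ of $\{1,\ldots,n\}$ and $c(\pi)$ is the number of cycles of $\pi$. $\mathbb{N}=\{0,1,2,\ldots\}$. For ${\bf k}=(k_1,\ldots,k_n)\in\mathbb{N}^n$ put $|{\bf k}|=\sum_l k_l$, and for $1\le m\le|{\bf k}|$ let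 $i_m=j$ where $j$ is determined by $\sum_{l=1}^{j-1}k_l<m\le\sum_{l=1}^{j}k_l$. For an $n\times n$ matrix $C=\{c_{i,j}\}$, $C({\bf k})$ is the $|{\bf k}|\times|{\bf k}|$ matrix with $(p,q)$ entry $c_{i_p,i_q}$; by convention $|C({\bf 0})|_\alpha=1$. $Z=Z_{\alpha,\overline B}$ is an $\mathbb{N}^n$-valued random variable with distribution $P(Z=(k_1,\ldots,k_n))=|\overline A|^{\alpha}\,\dfrac{|\overline B({\bf k})|_\alpha}{\prod_{i=1}^n k_i!}$ (these probabilities sum to 1). *)

(* Defs.v *)
From HB Require Import structures.
From mathcomp Require Import all_boot all_order all_algebra all_fingroup.
From mathcomp Require Import all_classical all_reals all_analysis.

Set Implicit Arguments.
Unset Strict Implicit.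
Unset Printing Implicit Defensive.

Import Order.TTheory GRing.Theory Num.Theory.

Local Open Scope ring_scope.

Definition nonsingular_M_matrix (R : realType) (n : nat) (A : 'M[R]_n) : Prop :=
  [/\ forall i j : 'I_n, i != j -> A i j <= 0,
      A \in unitmx &
      forall i j : 'I_n, 0 <= invmx A i j].

(* A = D_A - B, Abar = D_A^-1 A = I - Bbar, Bbar = D_A^-1 B *)
Definition diagpart (R : realType) (n : nat) (A : 'M[R]_n) : 'M[R]_n :=
  diag_mx (\row_i A i i).

Definition offpart (R : realType) (n : nat) (A : 'M[R]_n) : 'M[R]_n :=
  diagpart A - A.

Definition Abar (R : realType) (n : nat) (A : 'M[R]_n) : 'M[R]_n :=
  invmx (diagpart A) *m A.

Definition Bbar (R : realType) (n : nat) (A : 'M[R]_n) : 'M[R]_n :=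
  invmx (diagpart A) *m offpart A.

Definition Rbar (R : realType) (n : nat) (A : 'M[R]_n) (j : 'I_n) : R :=
  invmx A j j * A j j.

(* [porbits s] is the set of cycles of [s], fixed points included. *)
Definition alpha_permanent (R : realType) (alpha : R) (n : nat) (M : 'M[R]_n) : R :=
  \sum_(s : 'S_n) alpha ^+ #|porbits s| * \prod_(i < n) M i (s i).

(* The block index i_m (counting m from 0) is [tagnat.sig1 m]; see
   [block_indexP]. *)
Definition blowup (R : realType) (n : nat) (C : 'M[R]_n) (k : n.-tuple nat) :
    'M[R]_(\sum_(i < n) tnth k i) :=
  \matrix_(p, q) C (tagnat.sig1 p) (tagnat.sig1 q).

Lemma block_indexP (n : nat) (k : n.-tuple nat)
    (p : 'I_(\sum_(i < n) tnth k i)) (j : 'I_n) :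
  (tagnat.sig1 p == j) =
  (\sum_(l < n | (l < j)%N) tnth k l <= p < \sum_(l < n | (l <= j)%N) tnth k l)%N.
Proof.
have S (i : 'I_n) : (\sum_(l < n | (l <= i)%N) tnth k l =
    \sum_(l < n | (l < i)%N) tnth k l + tnth k i)%N.
  rewrite (bigD1 i)//= addnC; congr addn; apply: eq_bigl => l.
  by rewrite ltn_neqAle andbC.
have mono (a b : 'I_n) : (a < b)%N ->
    (\sum_(l < n | (l <= a)%N) tnth k l <= \sum_(l < n | (l < b)%N) tnth k l)%N.
  move=> ab; rewrite [leqRHS](bigID (fun l : 'I_n => (l <= a)%N))/=.
  rewrite (eq_bigl (fun l : 'I_n => (l < b)%N && (l <= a)%N)) ?leq_addr// => l.
  by case: (leqP l a) => la; rewrite ?andbF// (leq_ltn_trans la ab).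
have := tagnat.rect p; set i := tagnat.sig1 p => pE.
have lo : (\sum_(l < n | (l < i)%N) tnth k l <= p)%N.
  by rewrite [leqRHS]pE leq_addr.
have hi : (p < \sum_(l < n | (l <= i)%N) tnth k l)%N.
  by rewrite [ltnLHS]pE S ltn_add2l.
have [<-|neq] := eqVneq i j; first by rewrite lo hi.
apply/esym/negP => /andP[lo' hi'].
case: (ltngtP i j) => [ij|ji|/val_inj ij]; last by rewrite ij eqxx in neq.
- by have := leq_trans hi (leq_trans (mono _ _ ij) lo'); rewrite ltnn.
- by have := leq_trans hi' (leq_trans (mono _ _ ji) lo); rewrite ltnn.
Qed.

(* P(Z = k) for Z = Z_{alpha, Bbar} *)
Definition Z_pmf (R : realType) (alpha : R) (n : nat) (A : 'M[R]_n)
    (k : n.-tuple nat) : R :=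
  (\det (Abar A) `^ alpha) * alpha_permanent alpha (blowup (Bbar A) k)
    / (\prod_(i < n) ((tnth k i)`!)%:R).

(* Main.v *)
Require Import Defs.
From HB Require Import structures.
From mathcomp Require Import all_boot all_order all_algebra all_fingroup.
From mathcomp Require Import all_classical all_reals all_analysis.
From mathcomp Require Import measurable_realfun ring lra.

(** Write C for Bbar, r for the j-th diagonal entry of (I - C)^-1, which is
    Rbar_jj, and q t = P (Z_j = t). In fact Z_j is negative binomial with
    parameters alpha and 1 - 1/r, and the statement gives its rising factorial
    moments. They follow from the recursion
      r (t + 1) q (t + 1) = (r - 1) (alpha + t) q t     [coord_prob_next]
    together with sum_t q t = 1; the constant |Abar|^alpha is a common factor of
    both sides of the recursion.

    Combinatorics. The alpha-permanent W(k) of C(k) sums weighted permutations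
    of |k| points labelled by states. Suppose one more point is added, which is
    left from state j and entered as state i; call the resulting sum V_i(k).
    Splicing this point out of its cycle either removes a fixed point (the
    factor alpha C_ji) or glues it to its predecessor, which is a point of some
    state i'. That point is then left from j and entered as i', so that
      V_i(k) = alpha C_ji W(k) + sum_i' k_i' C_i'i V_i'(k - e_i')
    [rooted_permanent_expand], while V_j(k) = W(k + e_j)
    [blowup_permanent_incr] because a point left from j and entered as j is an
    ordinary point of state j. Divided by k! and summed over the vectors with
    |k| = N and k_j = t, this becomes a renewal equation in N for the sums
    S_i N of the rooted weights, in which the state j has become absorbing. Up to
    the normalising constant, its input is f N = (alpha + t) P (|Z| = N, Z_j = t)
    [rooted_level_weightS].

    Limit in N. Multiplying the renewal equation by the nonnegative matrix
    X = (I - C)^-1 bounds all partial sums of S; this is where the nonnegativity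
    of the inverse of an M-matrix is used. Hence the terms S_i N vanish as N grows, and the equation
    for total masses is  sigma r = (r - 1) sum_N f N,  where
    sigma = sum_N S_j N = (t + 1) q (t + 1)  [excursion_series].

    Moments. If u_m t = q t (alpha + t)_m / (alpha)_m, with rising factorials,
    then the recursion for q reads
      r (u_(m+1) (t + 1) - u_m (t + 1)) = (r - 1) u_(m+1) t,
    which telescopes: each moment is r times the preceding one
    [moment_telescope, rising_moments]. *)

Set Implicit Arguments.
Unset Strict Implicit.
Unset Printing Implicit Defensive.

Import Order.TTheory GRing.Theory Num.Theory.
Import numFieldNormedType.Exports.

Local Open Scope ring_scope.

(** * Alpha-permanents over finite types *)

Section FinPermanent.
Context {R : comNzRingType} (alpha : R).

Definition fin_permanent (I : finType) (M : I -> I -> R) : R :=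
  \sum_(s : {perm I}) alpha ^+ #|porbits s| * \prod_i M i (s i).

Lemma eq_fin_permanent (I : finType) (M N : I -> I -> R) :
  M =2 N -> fin_permanent M = fin_permanent N.
Proof.
by move=> MN; apply: eq_bigr => s _; congr (_ * _); apply: eq_bigr => i _.
Qed.

(** Covers both a change of indexing type ([h] bijective) and the addition of a
    fixed point ([h] = [Some]). *)
Lemma porbit_intertwine (I J : finType) (h : I -> J) (s : {perm I})
    (t : {perm J}) x :
  (forall x, t (h x) = h (s x)) -> porbit t (h x) = h @: porbit s x.
Proof.
move=> th; have thn i y : (t ^+ i)%g (h y) = h ((s ^+ i)%g y).
  by elim: i => [|i IH]; rewrite ?expg0 ?perm1// !expgSr !permM IH th.
apply/setP => y; apply/porbitP/imsetP => [[i ->]|[z /porbitP[i ->] ->]].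
  by exists ((s ^+ i)%g x); rewrite ?mem_porbit// thn.
by exists i; rewrite thn.
Qed.

Definition transport_perm (I J : finType) (h : I -> J) (g : J -> I)
    (hK : cancel h g) (gK : cancel g h) (s : {perm I}) : {perm J} :=
  perm (inj_comp (can_inj hK) (inj_comp (@perm_inj _ s) (can_inj gK))).

Lemma fin_permanent_bij (I J : finType) (h : I -> J) (M : J -> J -> R) :
  bijective h -> fin_permanent M = fin_permanent (fun x y => M (h x) (h y)).
Proof.
case=> g hK gK; rewrite /fin_permanent.
pose tr := transport_perm hK gK.
have trE s x : tr s (h x) = h (s x) by rewrite permE /= hK.
rewrite (reindex tr) /=; last first.
  exists (transport_perm gK hK) => s _; apply/permP => x; rewrite !permE /=.
    by rewrite trE !hK.
  by rewrite permE /= !gK.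
apply: eq_bigr => s _; congr (_ ^+ _ * _); last first.
  rewrite (reindex h) /=; last by exists g => x _; rewrite ?hK ?gK.
  by apply: eq_bigr => x _; rewrite trE.
rewrite -(card_imset (mem (porbits s)) (imset_inj (can_inj hK))).
congr #|pred_of_set _|; apply/setP => A; apply/imsetP/imsetP => [[y _ ->]|[B]].
  exists (porbit s (g y)); first exact: imset_f.
  by rewrite -{1}[y]gK; apply: porbit_intertwine => x; rewrite trE.
case/imsetP => x _ -> ->; exists (h x) => //.
by apply/esym; apply: porbit_intertwine => z; rewrite trE.
Qed.

Definition extend_perm (I : finType) (s : {perm I}) : {perm option I} :=
  perm (inj_omap (@perm_inj _ s)).

Lemma card_porbits_extend (I : finType) (s : {perm I}) :
  #|porbits (extend_perm s)| = #|porbits s|.+1.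
Proof.
have extE x : extend_perm s (Some x) = Some (s x) by rewrite permE.
have pS x : porbit (extend_perm s) (Some x) = Some @: porbit s x.
  exact: porbit_intertwine.
have -> : porbits (extend_perm s) =
    porbit (extend_perm s) None |: (fun A : {set I} => Some @: A) @: porbits s.
  apply/setP => A; rewrite in_setU1; apply/imsetP/orP.
    case=> -[x|] _ ->; last by left.
    by right; rewrite pS; apply: imset_f; apply: imset_f.
  case=> [/eqP ->|/imsetP[B /imsetP[x _ ->] ->]]; first by exists None.
  by exists (Some x); rewrite ?pS.
rewrite cardsU1 card_imset; last by apply: imset_inj => x y [].
case: imsetP => // -[A _ /setP/(_ None)]; rewrite porbit_id => /esym/imsetP.
by case.
Qed.

(** Every permutation of [option I] arises once by choosing the preimage [p.1] of
    the new point [None] and the permutation [p.2] left after splicing [None] out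
    of its cycle. *)
Definition insert_perm (I : finType) (p : option I * {perm I}) :
  {perm option I} := (tperm None p.1 * extend_perm p.2)%g.

(** The preimage of [None] and the spliced permutation can be read off, which
    gives injectivity; a cardinality count does the rest. *)
Lemma insert_perm_bij (I : finType) : bijective (@insert_perm I).
Proof.
apply: inj_card_bij; last first.
  rewrite card_prod card_option -!cardsT.
  have cP (J : finType) : #|[set: {perm J}]| = (#|J|)`!.
    rewrite -(cardsT J) -card_perm; apply: eq_card => s.
    by rewrite !inE unfold_in; apply/esym/fintype.subsetP => x _; rewrite inE.
  by rewrite !cP card_option cardsT factS.
move=> [q s] [q' s'] /= E.
have pre q0 (s0 : {perm I}) : insert_perm (q0, s0) q0 = None.
  by rewrite permM tpermR permE.
have qq' : q = q'.
  by apply: (@perm_inj _ (insert_perm (q, s))); rewrite pre E pre.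
subst q'; congr pair; have /permP e := mulgI _ _ _ E.
by apply/permP => x; have := e (Some x); rewrite !permE /= => -[].
Qed.

(** Splicing the point [None] out of its cycle. If it is a fixed point, a whole
    cycle disappears, hence the factor [alpha]. Otherwise its predecessor [q]
    takes over its outgoing arrow, that is, the row of [None], and the number of
    cycles does not change. *)
Lemma fin_permanent_option (I : finType) (M : option I -> option I -> R) :
  fin_permanent M =
  alpha * M None None * fin_permanent (fun x y => M (Some x) (Some y)) +
  \sum_q M (Some q) None *
    fin_permanent (fun x y => M (if x == q then None else Some x) (Some y)).
Proof.
rewrite /fin_permanent (reindex (@insert_perm I)) /=; last first.
  exact: onW_bij (insert_perm_bij I).
rewrite -(pair_bigA _ (fun q s => alpha ^+ #|porbits (insert_perm (q, s))| *
  \prod_i M i (insert_perm (q, s) i))) /=.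
rewrite (bigD1 None) //=; congr (_ + _).
  rewrite mulr_sumr; apply: eq_bigr => s _.
  rewrite /insert_perm /= tperm1 mul1g card_porbits_extend exprS.
  rewrite (bigD1 None) //= permE /=.
  rewrite (reindex_omap Some id) /=; last by case.
  rewrite mulrACA; congr (_ * _); congr (_ * _).
  by apply: eq_big => [x|x _]; rewrite ?eqxx // permE.
rewrite (reindex_omap Some id) /=; last by case.
apply: eq_big => [x|q _]; first by rewrite eqxx.
rewrite mulr_sumr; apply: eq_bigr => s _.
have -> : #|porbits (insert_perm (Some q, s))| = #|porbits s|.
  have /= := porbits_mul_tperm (extend_perm s) None (Some q).
  rewrite card_porbits_extend /= addn1.
  rewrite (porbit_intertwine (h := Some) (s := s)); last by move=> x; rewrite permE.
  rewrite (_ : None \notin _) /=; last by apply/imsetP => -[].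
  by rewrite addn2 => -[].
rewrite mulrCA; congr (_ * _).
rewrite (bigD1 None) //= (bigD1 (Some q)) //= (bigD1 q) //= eqxx.
rewrite !permM tpermL tpermR !permE /= mulrCA; congr (_ * (_ * _)).
rewrite (reindex_omap Some id) /=; last by case.
apply: eq_big => [x|x]; first by rewrite eqxx andbT.
move=> xq; rewrite permM tpermD ?permE//; last first.
  by rewrite eq_sym -[_ == _](inj_eq (@Some_inj _)) in xq *; case/andP: xq.
by congr (M _ _); case: eqP => // xx; move: xq; rewrite xx eqxx.
Qed.

End FinPermanent.

(** * Matrices constant on blocks *)

(** The points of each fibre are matched in the order of their enumerations. *)
Lemma label_bijection (I J L : finType) (l : I -> L) (l' : J -> L) :
  (forall c, #|[pred x | l x == c]| = #|[pred y | l' y == c]|) ->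
  exists2 h : I -> J, bijective h & forall x, l' (h x) = l x.
Proof.
move=> eqc.
have cIJ : #|I| = #|J|.
  rewrite -sum1_card -[RHS]sum1_card (partition_big l predT) //.
  rewrite [RHS](partition_big l' predT) //; apply: eq_bigr => c _.
  by rewrite !sum1_card -eqc.
case: (pickP (@predT J)) => [y0 _|J0]; last first.
  have I0 (x : I) : False.
    have /eq_card0 J0' := J0; move: cIJ; rewrite J0' => /card0_eq/(_ x).
    by rewrite inE.
  exists (fun x => False_rect J (I0 x)) => [|x]; last by case: (I0 x).
  by apply: inj_card_bij => [x|]; [case: (I0 x) | rewrite cIJ].
pose e c := enum [pred x | l x == c].
pose e' c := enum [pred y | l' y == c].
pose h x := nth y0 (e' (l x)) (index x (e (l x))).
have idx x : (index x (e (l x)) < size (e' (l x)))%N.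
  by rewrite -cardE -eqc cardE index_mem mem_enum inE.
have lh x : l' (h x) = l x.
  by have := mem_nth y0 (idx x); rewrite mem_enum inE => /eqP.
exists h => //; apply: inj_card_bij; last by rewrite cIJ.
move=> x y hxy; have lxy : l x = l y by rewrite -!lh hxy.
move: hxy; rewrite /h lxy => /eqP.
rewrite nth_uniq ?enum_uniq -?lxy ?idx// lxy ?idx// => /eqP ixy.
have := congr1 (nth x (e (l y))) ixy.
by rewrite !nth_index // mem_enum inE ?lxy.
Qed.

(** The reason why only the multiplicity vector [k] matters in an alpha-permanent
    of a blow-up: a kernel that sees its arguments through labels has a permanent
    depending only on how often each label occurs. *)
Lemma fin_permanent_label (R : comNzRingType) (alpha : R) (I J L : finType)
    (l : I -> L) (l' : J -> L) (M : L -> L -> R) :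
  (forall c, #|[pred x | l x == c]| = #|[pred y | l' y == c]|) ->
  fin_permanent alpha (fun x y => M (l x) (l y)) =
  fin_permanent alpha (fun x y => M (l' x) (l' y)).
Proof.
move=> /label_bijection[h hb lh]; rewrite [RHS](fin_permanent_bij _ _ hb).
by apply: eq_fin_permanent => x y; rewrite !lh.
Qed.

Lemma card_block (n : nat) (k : n.-tuple nat) (i : 'I_n) :
  #|[pred p : 'I_(\sum_(i < n) tnth k i) | tagnat.sig1 p == i]| = tnth k i.
Proof.
rewrite -[RHS]card_ord -(card_imset predT (f := tagnat.Rank i)); last first.
  by move=> a b /(congr1 val)/eqP; rewrite tagnat.eq_Rank eqxx => /eqP/val_inj.
apply: eq_card => p; rewrite inE; apply/eqP/imsetP => [<-|[a _ ->]].
  by exists (tagnat.sig2 p); rewrite ?tagnat.sig2K.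
exact: tagnat.Rank1K.
Qed.

(** * Blow-ups with one extra rooted point *)

Lemma card_option_pred (I : finType) (P : pred (option I)) :
  #|[pred y | P y]| = (P None + #|[pred x | P (Some x)]|)%N.
Proof.
rewrite -!sum1_card big_mkcond (bigD1 None) //= (reindex_omap Some id) /=; last by case.
rewrite [in RHS]big_mkcond; congr (_ + _)%N.
by apply: eq_big => [x|x _]; rewrite ?eqxx.
Qed.

Section Blowup.
Context {R : realType} (alpha : R) {n : nat} (C : 'M[R]_n).

Definition incr (i : 'I_n) (k : n.-tuple nat) : n.-tuple nat :=
  [tuple (tnth k a + (a == i))%N | a < n].

Definition decr (i : 'I_n) (k : n.-tuple nat) : n.-tuple nat :=
  [tuple (tnth k a - (a == i))%N | a < n].

Lemma incrK i : cancel (incr i) (decr i).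
Proof. by move=> k; apply: eq_from_tnth => a; rewrite !tnth_mktuple addnK. Qed.

Lemma decrK i k : (0 < tnth k i)%N -> incr i (decr i k) = k.
Proof.
move=> k0; apply: eq_from_tnth => a; rewrite !tnth_mktuple subnK//.
by case: eqP => // ->.
Qed.

Definition blowup_permanent (k : n.-tuple nat) : R :=
  alpha_permanent alpha (blowup C k).

Lemma blowup_permanentE k : blowup_permanent k = fin_permanent alpha
  (fun p q : 'I_(\sum_(i < n) tnth k i) => C (tagnat.sig1 p) (tagnat.sig1 q)).
Proof.
apply: eq_bigr => s _; congr (_ * _); apply: eq_bigr => p _.
by rewrite mxE.
Qed.

(** The extra point [None] is left from the state [j] (row label) but entered as
    the state [i] (column label). *)
Definition rooted_permanent (j i : 'I_n) (k : n.-tuple nat) : R :=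
  fin_permanent alpha (fun x y : option 'I_(\sum_(i < n) tnth k i) =>
    C (oapp tagnat.sig1 j x) (oapp tagnat.sig1 i y)).

Lemma blowup_permanent_incr j k :
  blowup_permanent (incr j k) = rooted_permanent j j k.
Proof.
rewrite blowup_permanentE.
apply: (fin_permanent_label _ (l' := oapp tagnat.sig1 j) (fun a b => C a b)) => c.
by rewrite card_block tnth_mktuple card_option_pred /= card_block addnC eq_sym.
Qed.

(** Splicing out the rooted point hands its row label [j] to the predecessor [q];
    if [q] lies in the block [i'], then [q] is now itself the rooted point, entered
    as [i'], of a blow-up with one point less in that block. When [k_i' = 0] the
    factor [k_i'] cancels the meaningless [decr i' k]. *)
Lemma rooted_permanent_expand j i k :
  rooted_permanent j i k = alpha * C j i * blowup_permanent k +
  \sum_i' (tnth k i')%:R * (C i' i * rooted_permanent j i' (decr i' k)).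
Proof.
rewrite /rooted_permanent fin_permanent_option /= -blowup_permanentE.
congr (_ + _); rewrite (partition_big (@tagnat.sig1 _ _) predT) //=.
apply: eq_bigr => i' _.
rewrite (eq_bigr (fun _ => C i' i * rooted_permanent j i' (decr i' k))); last first.
  move=> q /eqP qi; rewrite qi; congr (_ * _).
  (* The Boolean label marks the distinguished point: [q] on the left, [None] on
     the right. *)
  pose M (a b : 'I_n * bool) := C (if a.2 then j else a.1) b.1.
  pose l (x : 'I_(\sum_(i < n) tnth k i)) := (tagnat.sig1 x, x == q).
  pose l' (y : option 'I_(\sum_(a < n) tnth (decr i' k) a)) :=
    (oapp tagnat.sig1 i' y, ~~ isSome y).
  transitivity (fin_permanent alpha (fun x y => M (l x) (l y))).
    by apply: eq_fin_permanent => x y; rewrite /M /=; case: eqP.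
  transitivity (fin_permanent alpha (fun x y => M (l' x) (l' y))); last first.
    by apply: eq_fin_permanent => -[x|] y.
  apply: fin_permanent_label => -[c b]; rewrite card_option_pred.
  have e1 : #|[pred x | l x == (c, true)]| = (c == i')%N.
    have [->|ci] := eqVneq c i'.
      transitivity #|pred1 q|; last by rewrite card1.
      apply: eq_card => x; rewrite !inE xpair_eqE eqb_id.
      by case: (x =P q) => [->|]; rewrite ?qi ?eqxx ?andbF.
    apply: eq_card0 => x; rewrite !inE xpair_eqE eqb_id.
    case: (x =P q) => [->|]; last by rewrite andbF.
    by rewrite qi eq_sym (negbTE ci).
  have e2 : (#|[pred x | l x == (c, true)]| +
      #|[pred x | l x == (c, false)]|)%N = tnth k c.
    rewrite -(card_block k c) -[RHS](cardID (pred1 q)).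
    by congr (_ + _)%N; apply: eq_card => x;
      rewrite !inE xpair_eqE; case: (x =P q); rewrite ?andbT ?andbF.
  case: b.
    rewrite e1 xpair_eqE eqxx andbT /= eq_card0 ?addn0 1?eq_sym// => x.
    by rewrite !inE xpair_eqE andbF.
  rewrite xpair_eqE andbF /= add0n.
  transitivity (tnth (decr i' k) c).
    by rewrite tnth_mktuple -e2 e1 addKn.
  by rewrite -card_block; apply: eq_card => x; rewrite !inE xpair_eqE andbT.
by rewrite sumr_const mulr_natl; congr (_ *+ _); rewrite -(card_block k i').
Qed.

Hypothesis C0 : forall i i', 0 <= C i i'.
Hypothesis alpha0 : 0 < alpha.

Lemma fin_permanent_ge0 (I : finType) (M : I -> I -> R) :
  (forall x y, 0 <= M x y) -> 0 <= fin_permanent alpha M.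
Proof.
move=> M0; apply: sumr_ge0 => s _; apply: mulr_ge0.
  by rewrite exprn_ge0 ?ltW.
exact: prodr_ge0.
Qed.

Lemma blowup_permanent_ge0 k : 0 <= blowup_permanent k.
Proof. by rewrite blowup_permanentE; exact: fin_permanent_ge0. Qed.

Lemma rooted_permanent_ge0 j i k : 0 <= rooted_permanent j i k.
Proof. exact: fin_permanent_ge0. Qed.

End Blowup.

(** * Sums over the vectors of given total and given j-th entry *)

Section Level.
Context {n : nat} (j : 'I_n).

Definition level (N t : nat) : seq (n.-tuple nat) :=
  [seq k <- [seq map_tuple val x | x : n.-tuple 'I_N.+1] |
    (\sum_a tnth k a == N)%N && (tnth k j == t)].

Lemma mem_level N t k :
  (k \in level N t) = (\sum_a tnth k a == N)%N && (tnth k j == t).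
Proof.
rewrite mem_filter andb_idr // => /andP[/eqP kN _].
apply/fintype.imageP; exists [tuple inord (tnth k a) | a < n] => //.
apply: eq_from_tnth => a; rewrite tnth_map tnth_mktuple /= inordK //.
by rewrite ltnS -kN (bigD1 a) //= leq_addr.
Qed.

Lemma level_uniq N t : uniq (level N t).
Proof.
apply: filter_uniq; rewrite map_inj_uniq ?enum_uniq // => x y /(congr1 val) /=.
by move=> /(inj_map val_inj) /val_inj.
Qed.

Lemma sum_incr i (k : n.-tuple nat) :
  (\sum_a tnth (incr i k) a = (\sum_a tnth k a).+1)%N.
Proof.
under eq_bigr do rewrite tnth_mktuple.
rewrite big_split /= -addn1; congr (_ + _)%N.
by rewrite (bigD1 i) //= eqxx big1 ?addn0 // => a /negbTE ->.
Qed.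

(** Removing one point of the state [i] lowers the total by one, and the [j]-th
    entry only when [j = i]. *)
Lemma perm_level_incr i N t :
  perm_eq [seq k <- level N.+1 (t + (j == i)) | (0 < tnth k i)%N]
          [seq incr i k | k <- level N t].
Proof.
apply: uniq_perm; first by rewrite filter_uniq ?level_uniq.
  by rewrite map_inj_uniq ?level_uniq //; exact: (can_inj (@incrK n i)).
move=> k; rewrite mem_filter mem_level; apply/idP/mapP.
  case/andP => k0; rewrite -(decrK k0) sum_incr eqSS => kl.
  exists (decr i k); rewrite ?decrK// mem_level.
  by move: kl; rewrite tnth_mktuple eqn_add2r.
move=> [k']; rewrite mem_level => kl ->.
rewrite sum_incr eqSS !tnth_mktuple eqn_add2r kl.
by rewrite eqxx addn1.
Qed.

Lemma sum_level_incr (R : nmodType) i N t (g : n.-tuple nat -> R) :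
  \sum_(k <- level N.+1 (t + (j == i)) | (0 < tnth k i)%N) g (decr i k) =
  \sum_(k <- level N t) g k.
Proof.
rewrite -big_filter (perm_big _ (perm_level_incr i N t)) big_map.
by apply: eq_bigr => k _; rewrite incrK.
Qed.

End Level.

Section LevelSums.
Context {R : realType} (alpha : R) {n : nat} (C : 'M[R]_n) (j : 'I_n).

Definition fact_prod (k : n.-tuple nat) : R := \prod_i ((tnth k i)`!)%:R.

Lemma fact_prod_gt0 k : 0 < fact_prod k.
Proof. by apply: prodr_gt0 => i _; rewrite ltr0n fact_gt0. Qed.

Lemma fact_prod_incr i k : fact_prod (incr i k) = (tnth k i).+1%:R * fact_prod k.
Proof.
rewrite /fact_prod (bigD1 i) //= [in RHS](bigD1 i) //= tnth_mktuple eqxx addn1.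
rewrite factS natrM -mulrA; congr (_ * (_ * _)).
by apply: eq_bigr => a /negbTE ai; rewrite tnth_mktuple ai addn0.
Qed.

Definition weight (k : n.-tuple nat) : R := blowup_permanent alpha C k / fact_prod k.

Definition rooted_weight (i : 'I_n) (k : n.-tuple nat) : R :=
  rooted_permanent alpha C j i k / fact_prod k.

Lemma rooted_weight_root k :
  rooted_weight j k = (tnth k j).+1%:R * weight (incr j k).
Proof.
rewrite /weight blowup_permanent_incr fact_prod_incr /rooted_weight.
by field; rewrite gt_eqF ?fact_prod_gt0 // nat1r pnatr_eq0.
Qed.

(** In the expansion of the rooted permanent the term [i' = j] closes up into an
    ordinary blow-up, which turns [alpha] into [alpha + k_j]: the state [j] has
    become absorbing and [k_j] is the only trace of the visits to it. *)
Lemma rooted_weight_expand i k :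
  rooted_weight i k = C j i * (alpha + (tnth k j)%:R) * weight k +
  \sum_(i' | i' != j)
    if (0 < tnth k i')%N then C i' i * rooted_weight i' (decr i' k) else 0.
Proof.
rewrite {1}/rooted_weight rooted_permanent_expand mulrDl.
rewrite (bigD1 j) //= mulrDl addrA; congr (_ + _).
  rewrite /weight; have [->|k0] := posnP (tnth k j); first by rewrite mulr0n; ring.
  rewrite -blowup_permanent_incr decrK//; ring.
rewrite mulr_suml; apply: eq_bigr => i' _; rewrite /rooted_weight.
have [->|k0] := posnP (tnth k i'); first by rewrite mulr0n !mul0r.
rewrite -{3}(decrK k0) fact_prod_incr tnth_mktuple eqxx subn1 prednK//.
by field; rewrite gt_eqF ?fact_prod_gt0 // pnatr_eq0 -lt0n k0.
Qed.

Definition level_weight (N t : nat) : R := \sum_(k <- level j N t) weight k.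

Definition rooted_level_weight (i : 'I_n) (N t : nat) : R :=
  \sum_(k <- level j N t) rooted_weight i k.

Lemma rooted_level_weight_root N t :
  rooted_level_weight j N t = t.+1%:R * level_weight N.+1 t.+1.
Proof.
rewrite /rooted_level_weight -(sum_level_incr j j) eqxx addn1 mulr_sumr.
rewrite big_seq_cond [RHS]big_seq_cond; apply: eq_big => [k|k].
  by rewrite mem_level andbT; case: eqP => //= _; case: eqP => //= ->.
rewrite mem_level => /andP[/andP[_ /eqP kt] k0].
by rewrite rooted_weight_root decrK // tnth_mktuple eqxx kt subn1.
Qed.

Lemma rooted_level_weight0 i t :
  rooted_level_weight i 0 t = C j i * (alpha + t%:R) * level_weight 0 t.
Proof.
rewrite /rooted_level_weight /level_weight mulr_sumr big_seq_cond [RHS]big_seq_cond.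
apply: eq_bigr => k; rewrite andbT mem_level => /andP[/eqP k0 /eqP kt].
rewrite rooted_weight_expand kt big1 ?addr0// => i' _.
by move/eqP: k0; rewrite sum_nat_eq0 => /forallP/(_ i')/eqP ->.
Qed.

(** Since [j] is left out of the sum, [t] is the same on both sides, and this is a
    renewal equation in the total [N] alone. *)
Lemma rooted_level_weightS i N t :
  rooted_level_weight i N.+1 t = C j i * (alpha + t%:R) * level_weight N.+1 t +
  \sum_(i' | i' != j) C i' i * rooted_level_weight i' N t.
Proof.
under eq_bigr do rewrite mulr_sumr.
rewrite /rooted_level_weight /level_weight mulr_sumr.
transitivity (\sum_(k <- level j N.+1 t) (C j i * (alpha + t%:R) * weight k +
  \sum_(i' | i' != j)
    if (0 < tnth k i')%N then C i' i * rooted_weight i' (decr i' k) else 0)).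
  rewrite big_seq_cond [RHS]big_seq_cond.
  apply: eq_bigr => k; rewrite andbT mem_level => /andP[_ /eqP kt].
  by rewrite rooted_weight_expand kt.
rewrite big_split /=; congr (_ + _); rewrite exchange_big /=.
apply: eq_bigr => i' ij; rewrite -big_mkcond /=.
rewrite -(sum_level_incr j i' N t (fun k => C i' i * rooted_weight i' k)).
by rewrite eq_sym (negbTE ij) addn0.
Qed.

Hypothesis C0 : forall i i', 0 <= C i i'.
Hypothesis alpha0 : 0 < alpha.

Lemma rooted_level_weight_ge0 i N t : 0 <= rooted_level_weight i N t.
Proof.
apply: sumr_ge0 => k _; apply: divr_ge0 (ltW (fact_prod_gt0 k)).
exact: rooted_permanent_ge0.
Qed.

Lemma level_weight_ge0 N t : 0 <= level_weight N t.
Proof.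
apply: sumr_ge0 => k _; apply: divr_ge0 (ltW (fact_prod_gt0 k)).
exact: blowup_permanent_ge0.
Qed.

End LevelSums.

Local Open Scope classical_set_scope.

(** * The renewal equation and its total mass *)

Lemma nneg_bounded_series_cvg (R : realType) (u : nat -> R) (b : R) :
  (forall N, 0 <= u N) -> (forall N, series u N <= b) -> cvgn (series u).
Proof.
move=> u0 ub; apply: nondecreasing_is_cvgn.
  by apply: nondecreasing_series => N _ _; exact: u0.
by exists b => _ [N _ <-]; exact: ub.
Qed.

Section Renewal.
Context {R : realType} {n : nat} (C X : 'M[R]_n) (j : 'I_n).
Hypothesis CX : C *m X = X - 1%:M.
Hypothesis C0 : forall i i', 0 <= C i i'.
Hypothesis X0 : forall i i', 0 <= X i i'.

Variables (f : nat -> R) (S : 'I_n -> nat -> R).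
Hypothesis S0 : forall i N, 0 <= S i N.
Hypothesis f0 : forall N, 0 <= f N.
Hypothesis Sinit : forall i, S i 0%N = C j i * f 0%N.
Hypothesis Snext : forall i N,
  S i N.+1 = C j i * f N.+1 + \sum_(i' | i' != j) C i' i * S i' N.

(** Let s be the row of the [S l]. The renewal equation reads
    s (N + 1) = (f (N + 1) - S_j N) C_j + s N C, where C_j is the j-th row, so
    multiplying on the right by X and using C X = X - I gives
    s (N + 1) X + s N = s N X + (f (N + 1) - S_j N) (C X)_j, which telescopes. *)
Lemma excursion_balance i N :
  \sum_l S l N * X l i + series (S i) N =
  (series f N.+1 - series (S j) N) * (C *m X) j i.
Proof.
elim: N => [|N IH].
  rewrite /series /= big_nat1 !big_geq // addr0 subr0 mxE mulr_sumr.
  by apply: eq_bigr => l _; rewrite Sinit mulrCA mulrA.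
have step l : S l N.+1 = C j l * (f N.+1 - S j N) + \sum_i' S i' N * C i' l.
  rewrite Snext [in RHS](bigD1 j) //= mulrBr -addrA; congr (_ + _).
  by rewrite addrA [C j l * _]mulrC addNr add0r; apply: eq_bigr => ? _; rewrite mulrC.
have -> : \sum_l S l N.+1 * X l i =
    (f N.+1 - S j N) * (C *m X) j i + \sum_l S l N * X l i - S i N.
  under eq_bigr do rewrite step mulrDl.
  rewrite big_split /= -addrA; congr (_ + _).
    by rewrite mxE mulr_sumr; apply: eq_bigr => l _; ring.
  transitivity (\sum_i' S i' N * (C *m X) i' i).
    rewrite [RHS](eq_bigr (fun i' => \sum_l S i' N * (C i' l * X l i))); last first.
      by move=> i' _; rewrite mxE mulr_sumr.
    rewrite exchange_big /=; apply: eq_bigr => l _; rewrite mulr_suml.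
    by apply: eq_bigr => i' _; rewrite mulrA.
  rewrite CX (eq_bigr (fun l => S l N * X l i - S l N * (l == i)%:R)); last first.
    by move=> l _; rewrite !mxE mulrBr.
  rewrite sumrB; congr (_ - _).
  rewrite (bigD1 i) //= eqxx big1 ?addr0 ?mulr1 // => l li.
  by rewrite (negbTE li) mulr0.
by move: IH; rewrite !seriesSr => IH; lra.
Qed.

(** As the left side of the balance is a sum of nonnegative terms, the partial
    sums of every [S i] are bounded; the series converge and their terms tend to
    0, which removes the boundary term [\sum_l S l N * X l i] in the limit. *)
Lemma excursion_series (phi : R) : series f @ \oo --> phi ->
  exists2 sigma : R, series (S j) @ \oo --> sigma & sigma * X j j = phi * (X j j - 1).
Proof.
move=> fphi.
have E i : (C *m X) j i = X j i - (j == i)%:R by rewrite CX !mxE.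
have CX0 i : 0 <= (C *m X) j i.
  by rewrite mxE sumr_ge0 // => l _; exact: mulr_ge0.
have fle N : series f N <= phi.
  have <- : limn (series f) = phi by apply: cvg_lim.
  apply: nondecreasing_cvgn_le; last by apply/cvg_ex; exists phi.
  by apply: nondecreasing_series => M _ _; exact: f0.
have ser0 i N : 0 <= series (S i) N by apply: sumr_ge0 => M _; exact: S0.
have Sle i N : series (S i) N <= phi * (C *m X) j i.
  apply: (@le_trans _ _ (\sum_l S l N * X l i + series (S i) N)).
    by rewrite lerDr sumr_ge0 // => l _; exact: mulr_ge0.
  rewrite excursion_balance ler_wpM2r// lerBlDr (le_trans (fle _))//.
  by rewrite lerDl.
have Scv i : cvgn (series (S i)).
  exact: nneg_bounded_series_cvg (S0 i) (Sle i).
exists (limn (series (S j))); first exact: Scv.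
set sigma := limn _.
have lhs : (fun N => \sum_l S l N * X l j + series (S j) N) @ \oo --> 0 + sigma.
  apply: cvgD; last exact: Scv.
  rewrite [X in _ --> X](_ : 0 = \sum_(l < n) 0 * X l j); last first.
    by rewrite big1 // => l _; rewrite mul0r.
  apply: cvg_big => [|l _]; first exact: add_continuous.
  by apply: cvgM; [exact: cvg_series_cvg_0|exact: cvg_cst].
have rhs : (fun N => (series f N.+1 - series (S j) N) * (C *m X) j j) @ \oo -->
    (phi - sigma) * (C *m X) j j.
  apply: cvgM; last exact: cvg_cst.
  apply: cvgB; last exact: Scv.
  by move: fphi; rewrite -cvg_shiftS.
rewrite (funext (excursion_balance j)) in lhs.
have := cvg_unique (@norm_hausdorff _ R^o) lhs rhs.
rewrite E eqxx add0r => e.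
have {}e : sigma = (phi - sigma) * (X j j - 1) by exact: e.
by move: (sigma : R) e => s e; lra.
Qed.

End Renewal.

(** * Rising factorial moments from a first-order recursion *)

Section RisingMoments.
Context {R : realType} (alpha r : R) (q : nat -> R).
Hypothesis alpha0 : 0 < alpha.
Hypothesis r1 : 1 <= r.
Hypothesis q0 : forall t, 0 <= q t.
Hypothesis qnext : forall t,
  r * (t.+1%:R * q t.+1) = (r - 1) * ((alpha + t%:R) * q t).

Definition rising_ratio (m t : nat) : R :=
  \prod_(0 <= l < m) ((alpha + t%:R + l%:R) / (alpha + l%:R)).

Let den0 l : alpha + l%:R != 0.
Proof. by rewrite gt_eqF// ltr_pwDl. Qed.

Lemma rising_ratio_ge0 m t : 0 <= rising_ratio m t.
Proof.
by apply: prodr_ge0 => l _; rewrite divr_ge0 // !addr_ge0 // ltW.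
Qed.

Lemma rising_ratioS m t : (alpha + m%:R) * rising_ratio m.+1 t =
  (alpha + t%:R + m%:R) * rising_ratio m t.
Proof. by rewrite /rising_ratio big_nat_recr //=; field; exact: den0. Qed.

(** Both sides are the rising factorial of length [m + 1] from [alpha + t], over
    that of length [m] from [alpha]. *)
Lemma rising_ratio_shift m t : (alpha + t%:R) * rising_ratio m t.+1 =
  (alpha + m%:R) * rising_ratio m.+1 t.
Proof.
elim: m => [|m IH].
  by rewrite /rising_ratio big_nat1 big_geq // !addr0 mulr1 mulrC divfK // gt_eqF.
rewrite rising_ratioS; apply: (mulfI (den0 m)).
rewrite mulrCA rising_ratioS mulrCA IH -natr1; ring.
Qed.

(** The boundary term [r * u m.+1 N] is nonnegative, so this identity also shows
    that the moment of order [m + 1] is finite once that of order [m] is. *)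
Lemma moment_telescope m N :
  let u m' t := q t * rising_ratio m' t in
  series (u m.+1) N + r * u m.+1 N = r * series (u m) N.+1.
Proof.
set u := fun m' t => q t * rising_ratio m' t => /=.
have ustep t : r * (u m.+1 t.+1 - u m t.+1) = (r - 1) * u m.+1 t.
  apply: (mulfI (den0 m)); rewrite /u.
  transitivity (r * (t.+1%:R * q t.+1) * rising_ratio m t.+1).
    transitivity (r * q t.+1 * ((alpha + m%:R) * rising_ratio m.+1 t.+1 -
      (alpha + m%:R) * rising_ratio m t.+1)); first by ring.
    by rewrite rising_ratioS; ring.
  rewrite qnext.
  transitivity ((r - 1) * q t * ((alpha + t%:R) * rising_ratio m t.+1)); first by ring.
  by rewrite rising_ratio_shift; ring.
elim: N => [|N IH].
  rewrite /series /= big_nat1 big_geq // add0r /u; congr (_ * (_ * _)).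
  by apply: (mulfI (den0 m)); rewrite rising_ratioS addr0.
rewrite [series (u m) _]seriesSr [series (u m.+1) _]seriesSr.
by have := ustep N; lra.
Qed.

Lemma rising_moments m : series q @ \oo --> (1 : R) ->
  series (fun t => q t * rising_ratio m t) @ \oo --> r ^+ m.
Proof.
move=> q1; elim: m => [|m IH].
  rewrite expr0 (_ : (fun t => _) = q) //.
  by apply/funext => t; rewrite /rising_ratio big_geq // mulr1.
set v := fun t => _ in IH; set u := fun t => _.
have u0 t : 0 <= u t by rewrite mulr_ge0 ?rising_ratio_ge0.
have v0 t : 0 <= v t by rewrite mulr_ge0 ?rising_ratio_ge0.
have E N : series u N + r * u N = r * series v N.+1 by exact: moment_telescope.
have r0 : 0 <= r by exact: le_trans r1.
have vle N : series v N <= r ^+ m.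
  have <- : limn (series v) = r ^+ m by apply: cvg_lim.
  apply: nondecreasing_cvgn_le; last by apply/cvg_ex; exists (r ^+ m).
  by apply: nondecreasing_series => M _ _; exact: v0.
have ucv : cvgn (series u).
  apply: (@nneg_bounded_series_cvg _ _ (r * r ^+ m)) => // N.
  apply: (@le_trans _ _ (series u N + r * u N)); first by rewrite lerDl mulr_ge0.
  by rewrite E ler_wpM2l.
have lim0 : (fun N => r * series v N.+1 - r * u N) @ \oo --> r * r ^+ m - r * 0.
  apply: cvgB; apply: cvgM; [exact: cvg_cst| |exact: cvg_cst|].
    by move: IH; rewrite -cvg_shiftS.
  exact: cvg_series_cvg_0.
rewrite mulr0 subr0 -exprS in lim0.
rewrite (_ : series u = fun N => r * series v N.+1 - r * u N) //.
by apply/funext => N; rewrite -E addrK.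
Qed.

End RisingMoments.

(** * Nonsingular M-matrices *)

Section MMatrix.
Context {R : realType} {n : nat} (A : 'M[R]_n).
Hypothesis hA : nonsingular_M_matrix A.

(** In the (i, i) entry of A A^-1 = I the off-diagonal terms are nonpositive, so
    A_ii (A^-1)_ii >= 1. *)
Lemma M_matrix_diag_gt0 i : 0 < A i i.
Proof.
case: hA => Aoff Au Ainv.
have /matrixP/(_ i i) := mulmxV Au; rewrite !mxE eqxx (bigD1 i) //= => e.
have : 1 <= A i i * invmx A i i.
  rewrite -[leLHS]e gerDl; apply: sumr_le0 => l li.
  by rewrite mulr_le0_ge0 // Aoff // eq_sym.
have := Ainv i i; rewrite le_eqVlt => /orP[/eqP <-|x0 y1].
  by rewrite mulr0 ler10.
by rewrite -(pmulr_lgt0 _ x0) (lt_le_trans _ y1).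
Qed.

Lemma diagpart_unit : diagpart A \in unitmx.
Proof.
rewrite unitmxE det_diag unitfE; apply/prodf_neq0 => i _.
by rewrite mxE gt_eqF // M_matrix_diag_gt0.
Qed.

Lemma invmx_diagpart : invmx (diagpart A) = diag_mx (\row_i (A i i)^-1).
Proof.
apply: (can_inj (mulKmx diagpart_unit)); rewrite mulmxV ?diagpart_unit //.
rewrite /diagpart mulmx_diag; apply/matrixP => i i'; rewrite !mxE.
by rewrite mulfV // gt_eqF // M_matrix_diag_gt0.
Qed.

Lemma Bbar_ge0 i i' : 0 <= Bbar A i i'.
Proof.
rewrite /Bbar invmx_diagpart mul_diag_mx !mxE.
apply: mulr_ge0; first by rewrite invr_ge0 ltW // M_matrix_diag_gt0.
have [->|ii'] := eqVneq i i'; first by rewrite mulr1n subrr.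
by rewrite mulr0n sub0r oppr_ge0; case: hA => + _ _; exact.
Qed.

(** The matrix (I - Bbar)^-1; see [Bbar_potential]. *)
Definition potential : 'M[R]_n := invmx A *m diagpart A.

Lemma Bbar_potential : Bbar A *m potential = potential - 1%:M.
Proof.
case: hA => _ Au _.
rewrite /Bbar /offpart mulmxBr mulVmx ?diagpart_unit // mulmxBl mul1mx.
by rewrite /potential -mulmxA mulKVmx // mulVmx // diagpart_unit.
Qed.

Lemma potential_ge0 i i' : 0 <= potential i i'.
Proof.
rewrite /potential /diagpart mul_mx_diag !mxE.
by rewrite mulr_ge0 // ?(ltW (M_matrix_diag_gt0 _)) //; case: hA.
Qed.

Lemma potential_diag i : potential i i = Rbar A i.
Proof. by rewrite /potential /diagpart mul_mx_diag !mxE. Qed.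

Lemma Rbar_ge1 i : 1 <= Rbar A i.
Proof.
rewrite -potential_diag -subr_ge0.
have /matrixP/(_ i i) := Bbar_potential; rewrite !mxE eqxx mulr1n => <-.
by apply: sumr_ge0 => l _; rewrite mulr_ge0 ?Bbar_ge0 ?potential_ge0.
Qed.

End MMatrix.

(** * The law of one coordinate *)

Section Law.
Context {R : realType} {n : nat} (A : 'M[R]_n) (alpha : R)
  {d : measure_display} {T : measurableType d} (P : probability T R)
  (Z : {RV P >-> n.-tuple nat}).
Hypothesis alpha0 : 0 < alpha.
Hypothesis hA : nonsingular_M_matrix A.
Hypothesis hZ : forall k : n.-tuple nat,
  distribution P Z [set k] = (Z_pmf alpha A k)%:E.
Variable j : 'I_n.

Let C := Bbar A.
Let c : R := \det (Abar A) `^ alpha.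

Lemma measurable_tnth_comp i : measurable_fun setT (fun w => tnth (Z w) i).
Proof. exact: (measurableT_comp (measurable_tnth i) (measurable_funPT Z)). Qed.

Definition coord_event (t : nat) : set T := [set w | tnth (Z w) j = t].

Definition level_event (t N : nat) : set T := [set w | Z w \in level j N t].

Lemma measurable_coord_event t : measurable (coord_event t).
Proof.
rewrite -[coord_event t]setTI.
exact: (measurable_tnth_comp j measurableT (Y := [set t])).
Qed.

Lemma measurable_preimage_point k : measurable (Z @^-1` [set k]).
Proof.
rewrite (_ : _ @^-1` _ = \bigcap_(i in [set: 'I_n]) [set w | tnth (Z w) i = tnth k i]).
  apply: fin_bigcap_measurable => // i _; rewrite -[X in measurable X]setTI.
  exact: (measurable_tnth_comp i measurableT (Y := [set tnth k i])).
apply/seteqP; split=> w /=; first by move=> <-.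
by move=> Zk; apply: eq_from_tnth => i; exact: Zk.
Qed.

Lemma level_eventE t N :
  level_event t N = \big[setU/set0]_(k <- level j N t) (Z @^-1` [set k]).
Proof.
rewrite -bigcup_seq; apply/seteqP; split=> w /=; first by move=> Zw; exists (Z w).
by move=> [k /= kl Zk]; rewrite /level_event /= Zk.
Qed.

Lemma measurable_level_event t N : measurable (level_event t N).
Proof.
rewrite level_eventE; apply: bigsetU_measurable => k _.
exact: measurable_preimage_point.
Qed.

Lemma level_event_prob t N :
  P (level_event t N) = (c * level_weight alpha C j N t)%:E.
Proof.
rewrite level_eventE fsbig_seq ?level_uniq //.
rewrite measure_fsbig //=; last 3 first.
- exact: finite_seq.
- by move=> k _; exact: measurable_preimage_point.
- by move=> k k' _ _ [w [/= -> ->]].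
rewrite -fsbig_seq ?level_uniq //=.
rewrite (eq_bigr (fun k => (c * weight alpha C k)%:E)); last first.
  by move=> k _; rewrite [LHS]hZ /Z_pmf /weight mulrA.
by rewrite sumEFin mulr_sumr.
Qed.

Definition coord_prob (t : nat) : R := fine (P (coord_event t)).

Lemma coord_probE t : P (coord_event t) = (coord_prob t)%:E.
Proof.
by rewrite fineK //; apply: fin_num_measure; exact: measurable_coord_event.
Qed.

Lemma coord_prob_ge0 t : 0 <= coord_prob t.
Proof. exact: fine_ge0. Qed.

Lemma measure_series_cvg (E : nat -> set T) (u : nat -> R) (v : R) :
  (forall N, measurable (E N)) -> trivIset setT E ->
  (forall N, P (E N) = (u N)%:E) -> P (\bigcup_N E N) = v%:E ->
  series u @ \oo --> v.
Proof.
move=> mE tE Eu Uv.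
have : (fun N => \sum_(0 <= i < N) P (E i))%E @ \oo --> P (\bigcup_N E N).
  exact: (@measure_sigma_additive _ _ _ P E mE tE).
rewrite Uv (_ : (fun N => _) = EFin \o series u); last first.
  by apply/funext => N; rewrite /= /series /= -sumEFin; apply: eq_bigr => M _.
by move/fine_cvgP => [].
Qed.

(** Splitting the event Z_j = t according to the total of Z. *)
Lemma level_series_cvg t :
  series (fun N => c * level_weight alpha C j N t) @ \oo --> coord_prob t.
Proof.
apply: (@measure_series_cvg (level_event t)).
- exact: measurable_level_event.
- move=> N M _ _ [w []]; rewrite /level_event /= !mem_level => /andP[/eqP <- _].
  by move=> /andP[/eqP <- _].
- exact: level_event_prob.
rewrite -coord_probE; congr (P _); apply/seteqP; split=> w /=.
  by move=> [N _]; rewrite /level_event /= mem_level => /andP[_ /eqP].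
by move=> Zt; exists (\sum_a tnth (Z w) a)%N => //; rewrite /level_event /=
  mem_level Zt !eqxx.
Qed.

Lemma coord_event_cover : \bigcup_t coord_event t = setT.
Proof. by apply/seteqP; split=> // w _; exists (tnth (Z w) j). Qed.

Lemma coord_event_disjoint : trivIset setT coord_event.
Proof. by move=> s t _ _ [w [/= <- <-]]. Qed.

Lemma coord_series_cvg : series coord_prob @ \oo --> (1 : R).
Proof.
apply: (@measure_series_cvg coord_event).
- exact: measurable_coord_event.
- exact: coord_event_disjoint.
- exact: coord_probE.
- by rewrite coord_event_cover probability_setT.
Qed.

(** [excursion_series] at fixed [t]: the input series has mass
    [(alpha + t) q t], and the series of the rooted weights at [j] has mass
    [(t + 1) q (t + 1)], since a rooted point entered as [j] is one more point of
    the state [j]. *)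
Lemma coord_prob_next t : Rbar A j * (t.+1%:R * coord_prob t.+1) =
  (Rbar A j - 1) * ((alpha + t%:R) * coord_prob t).
Proof.
have c0 : 0 <= c by exact: powR_ge0.
have C0 := Bbar_ge0 hA.
have cvZ (a l : R) (u : nat -> R) : series u @ \oo --> l ->
    series (fun N => a * u N) @ \oo --> a * l.
  move=> ul; rewrite (_ : series _ = fun N => a * series u N); last first.
    by apply/funext => N; rewrite /series /= mulr_sumr.
  by apply: cvgM => //; exact: cvg_cst.
(* With the constant [c] inside, the total mass of f is [(alpha + t) q t]. *)
pose f N := (alpha + t%:R) * (c * level_weight alpha C j N t).
pose S i N := c * rooted_level_weight alpha C j i N t.
have [sigma Ss] : exists2 sigma : R, series (S j) @ \oo --> sigma &
    sigma * potential A j j =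
    (alpha + t%:R) * coord_prob t * (potential A j j - 1).
  apply: (@excursion_series _ _ C (potential A) j _ _ _ f).
  - exact: Bbar_potential.
  - exact: C0.
  - exact: potential_ge0.
  - by move=> i N; rewrite mulr_ge0 // rooted_level_weight_ge0.
  - move=> N; rewrite mulr_ge0 ?addr_ge0 ?(ltW alpha0) // mulr_ge0 //.
    exact: level_weight_ge0.
  - by move=> i; rewrite /S rooted_level_weight0 /f; ring.
  - move=> i N; rewrite /S rooted_level_weightS mulrDr; congr (_ + _).
      by rewrite /f; ring.
    by rewrite mulr_sumr; apply: eq_bigr => i' _; rewrite mulrCA.
  - by apply: cvZ; exact: level_series_cvg.
rewrite potential_diag.
suff -> : sigma = t.+1%:R * coord_prob t.+1 by move=> e; rewrite mulrC e mulrC.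
have := cvZ t.+1%:R _ _ (@level_series_cvg t.+1).
rewrite -cvg_shiftS (_ : [sequence _]_N = series (S j)); last first.
  apply/funext => N; rewrite /series /= big_nat_recl //.
  rewrite /level_weight [X in t.+1%:R * (c * X)]big1_seq => [|k]; last first.
    rewrite mem_level andTb => /andP[/eqP k0 /eqP kt].
    by move/eqP: k0; rewrite sum_nat_eq0 => /forallP/(_ j); rewrite kt.
  rewrite !mulr0 add0r; apply: eq_bigr => M _.
  by rewrite /S rooted_level_weight_root mulrCA.
by move=> /(cvg_unique (@norm_hausdorff _ R^o) Ss).
Qed.

Lemma expectation_coord (g : nat -> R) (v : R) : (forall t, 0 <= g t) ->
  series (fun t => coord_prob t * g t) @ \oo --> v ->
  ('E_P[fun w => g (tnth (Z w) j)] = v%:E)%E.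
Proof.
(* The sets Z_j = t partition the space, and the integrand is constant on each. *)
move=> g0 cv; rewrite unlock -coord_event_cover ge0_integral_bigcup; last 4 first.
- exact: measurable_coord_event.
- rewrite coord_event_cover; apply/measurable_EFinP.
  by apply: (measurableT_comp _ (measurable_tnth_comp j)).
- by move=> w _; rewrite lee_fin.
- exact: coord_event_disjoint.
apply: cvg_lim => //.
rewrite (_ : (fun N => _) = EFin \o series (fun t => coord_prob t * g t)).
  by apply: cvg_EFin => //; exact: nearW.
apply/funext => N; rewrite /= /series /= -sumEFin; apply: eq_bigr => t _.
rewrite (eq_integral (fun=> (g t)%:E)); last first.
  by move=> w; rewrite inE => /= ->.
rewrite integral_cst; last exact: measurable_coord_event.
by rewrite [X in (_ * X)%E]coord_probE -EFinM mulrC.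
Qed.

End Law.

Local Open Scope ereal_scope.
Unset Implicit Arguments.
Theorem lemma1p6 (R : realType) (n : nat) (A : 'M[R]_n) (alpha : R)
    (d : measure_display) (T : measurableType d) (P : probability T R)
    (Z : {RV P >-> n.-tuple nat})
    (halpha : (0 < alpha)%R)
    (hA : nonsingular_M_matrix A)
    (hZ : forall k : n.-tuple nat, distribution P Z [set k]%classic = (Z_pmf alpha A k)%:E)
    (j : 'I_n) (m : nat) (hm : (1 <= m)%N) :
  ((Rbar A j) ^+ m)%:E =
  'E_P[(fun w : T => \prod_(0 <= l < m)
          ((alpha + (tnth (Z w) j)%:R + l%:R) / (alpha + l%:R)))%R].
Proof.
apply/esym; apply: (expectation_coord (rising_ratio_ge0 halpha m)).
apply: rising_moments => //.
- exact: Rbar_ge1.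
- exact: coord_prob_ge0.
- exact: coord_prob_next.
- exact: coord_series_cvg.
Qed.
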